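(* Let $\mathbf{c}=(c_1,\dots,c_m)$ be a vector of positive integers, $g\ge0$ an integer, $k$ a field, and $B$ a $k$-point of $\mathrm{Ter}^g_{\mathbf{c}}$. Let $I\sqcup I'$ be a partition of $[m]=\{1,\dots,m\}$ into nonempty subsets. There is a one-parameter subgroup $\gamma_I$ of the torus $T=(\mathbb{G}_m)^m$ such that the limit $\lim_{\gamma_I}B$ of $B$ under its action is in the image of the transverse union map $\vee:\mathrm{Ter}^{g_I}_{\mathbf{c}|_I}\times\mathrm{Ter}^{g_{I'}}_{\mathbf{c}|_{I'}}\to\mathrm{Ter}^g_{\mathbf{c}}$ for some integer partition $g_I+g_{I'}=g$ depending on $B$.
   Context: For a vector $\mathbf{c}=(c_1,\dots,c_m)$ of positive integers let $A^+_{\mathbf{c}}=\mathbb{Z}[t_1,\dots,t_m]/(t_i^{c_i},\ t_it_j : i\neq j)$ with ideal $\mathfrak{m}_{\mathbf{c}}=(t_1,\dots,t_m)$. The territory $\mathrm{Ter}^g_{\mathbf{c}}$ is the projective $\mathbb{Z}$-scheme representing the functor sending $S$ to the set of quasi-coherent $\mathcal{O}_S$-subalgebras $\mathscr{B}\subseteq A^+_{\mathbf{c}}\otimes\mathcal{O}_S$ with $(A^+_{\mathbf{c}}\otimes\mathcal{O}_S)/\mathscr{B}$ locally free of rank $g$; write $\mathfrak{m}_{\mathscr{B}}=\mathscr{B}\cap(\mathfrak{m}_{\mathbf{c}}\otimes\mathcal{O}_S)$. For $I=\{i_1<\dots<i_r\}\subseteq[m]$, $\mathbf{c}|_I=(c_{i_1},\dots,c_{i_r})$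 and $j_I:\mathfrak{m}_{\mathbf{c}|_I}\to\mathfrak{m}_{\mathbf{c}}$ is the natural inclusion. The transverse union map $\vee$ is given on $S$-points by $(\mathscr{B}_1,\mathscr{B}_2)\mapsto\mathcal{O}_S\cdot 1\oplus j_I(\mathfrak{m}_{\mathscr{B}_1})\oplus j_{I'}(\mathfrak{m}_{\mathscr{B}_2})$. The torus $T=(\mathbb{G}_m)^m$ acts on $A^+_{\mathbf{c}}$ by $(\lambda_1,\dots,\lambda_m)\cdot f(t_1,\dots,t_m)=f(\lambda_1t_1,\dots,\lambda_mt_m)$, hence on $\mathrm{Ter}^g_{\mathbf{c}}$ by taking images of subalgebras. For a one-parameter subgroup $\gamma:\mathbb{G}_m\to T$, $\lim_\gamma B$ is the $k$-point of $\mathrm{Ter}^g_{\mathbf{c}}$ obtained by extending the family $\lambda\mapsto\gamma(\lambda)\cdot B$ over $\mathbb{G}_m$ to $\mathbb{A}^1$ (uniquely, by properness) and restricting to $\lambda=0$. *)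

(* Defs.v *)
From HB Require Import structures.
From mathcomp Require Import all_boot all_algebra.
From mathcomp Require Import boolp mpoly.

Set Implicit Arguments.
Unset Strict Implicit.
Unset Printing Implicit Defensive.

Import GRing.Theory.
Local Open Scope ring_scope.
Local Open Scope quotient_scope.

Record posvec (m : nat) := PosVec {
  pv :> 'I_m -> nat;
  pv_gt0 : forall i, (0 < pv i)%N
}.

Definition posvec_restr (m : nat) (c : posvec m) (I : {set 'I_m}) :
    posvec #|I| :=
  PosVec (fun r => pv_gt0 c (enum_val r)).

(** [Aplus S c] is [S[t_1..t_m] / (t_i ^ c_i, t_i t_j : i <> j)], i.e. [A^+_c]
    tensored with [S], the presentation being stable under base change. *)

Section Algebra.
Variables (S : comNzRingType) (m : nat) (c : posvec m).

Definition rel_ideal (p : {mpoly S[m]}) : bool :=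
  `[< exists (a : 'I_m -> {mpoly S[m]}) (b : 'I_m -> 'I_m -> {mpoly S[m]}),
      p = \sum_i a i * 'X_i ^+ c i
          + \sum_i \sum_(j | j != i) b i j * ('X_i * 'X_j) >].

Lemma rel_ideal_closed : idealr_closed rel_ideal.
Proof.
split.
- apply/asboolP; exists (fun=> 0), (fun _ _ => 0).
  rewrite !big1 ?addr0 // => i _; first by rewrite big1 // => j _; rewrite mul0r.
  by rewrite mul0r.
- apply/asboolP => -[a [b /(congr1 (meval (fun=> 0)))]].
  rewrite rmorph1 rmorphD /= !rmorph_sum /= !big1 ?addr0.
  + by move/eqP; rewrite oner_eq0.
  + move=> i _; rewrite rmorph_sum /= big1 // => j _.
    by rewrite !rmorphM /= !mevalXU !mulr0.
  + move=> i _; rewrite rmorphM rmorphXn /= mevalXU expr0n.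
    by rewrite gtn_eqF ?pv_gt0 // mulr0.
- move=> u p q /asboolP[a [b ->]] /asboolP[a' [b' ->]].
  apply/asboolP; exists (fun i => u * a i + a' i).
  exists (fun i j => u * b i j + b' i j).
  rewrite mulrDr addrACA; congr (_ + _); rewrite mulr_sumr -big_split /=.
    by apply: eq_bigr => i _; rewrite mulrDl mulrA.
  apply: eq_bigr => i _; rewrite mulr_sumr -big_split /=.
  by apply: eq_bigr => j _; rewrite mulrDl -(mulrA u).
Qed.

HB.instance Definition _ :=
  isIdealr.Build {mpoly S[m]} rel_ideal rel_ideal_closed.

Definition rel_idealr : idealr {mpoly S[m]} := rel_ideal.

Definition Aplus : comNzRingType := {ideal_quot rel_idealr}.

Definition Api (p : {mpoly S[m]}) : Aplus := \pi_{ideal_quot rel_idealr} p.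

HB.instance Definition _ :=
  GRing.RMorphism.copy Api (\pi_{ideal_quot rel_idealr}).

Definition Acst (s : S) : Aplus := Api s%:MP.

HB.instance Definition _ :=
  GRing.RMorphism.copy Acst (Api \o @mpolyC m S).

Definition Agen (i : 'I_m) : Aplus := Api 'X_i.

Definition Amax (a : Aplus) : Prop :=
  exists h : 'I_m -> Aplus, a = \sum_i h i * Agen i.

(** The map out of the quotient with scalars sent through [f] and [t_i] sent
    to [h i]. It is independent of the representative when the relations are
    respected, see [Aeval_pi]. *)
Definition Aeval (T : comNzRingType) (f : {rmorphism S -> T})
    (h : 'I_m -> T) (a : Aplus) : T :=
  mmap f h (repr a).

Definition respects_rel (T : comNzRingType) (h : 'I_m -> T) : Prop :=
  (forall i, h i ^+ c i = 0) /\ (forall i j, j != i -> h i * h j = 0).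

Lemma Agen_rel : respects_rel Agen.
Proof.
have rel0 p : rel_ideal p -> Api p = 0.
  move=> pI; rewrite -(rmorph0 Api); apply/eqP.
  by rewrite -Quotient.idealrBE subr0.
split=> [i | i j ji].
- rewrite /Agen -rmorphXn; apply: rel0; apply/asboolP.
  exists (fun k => (k == i)%:R), (fun _ _ => 0).
  rewrite (bigD1 i) //= eqxx mul1r big1 ?addr0 => [|k /negPf->]; last first.
    by rewrite mul0r.
  rewrite big1 ?addr0 // => k _; rewrite big1 // => l _; exact: mul0r.
- rewrite /Agen -rmorphM; apply: rel0; apply/asboolP.
  exists (fun=> 0), (fun k l => ((k == i) && (l == j))%:R).
  rewrite big1 ?add0r => [|k _]; last exact: mul0r.
  rewrite (bigD1 i) //= [X in _ + X]big1 ?addr0 => [|k /negPf ki]; last first.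
    by rewrite big1 // => l _; rewrite ki mul0r.
  rewrite (bigD1 j) //= !eqxx mul1r big1 ?addr0 // => l /andP[_ /negPf->].
  by rewrite andbF mul0r.
Qed.

Lemma Aeval_pi (T : comNzRingType) (f : {rmorphism S -> T}) (h : 'I_m -> T) :
  respects_rel h -> forall p, Aeval f h (Api p) = mmap f h p.
Proof.
move=> [hX hXX] p; apply/eqP; rewrite -subr_eq0 /Aeval -rmorphB /=.
have : rel_ideal (repr (Api p) - p).
  by have := Quotient.idealrBE rel_idealr (repr (Api p)) p; rewrite reprK eqxx.
move=> /asboolP[a [b ->]]; rewrite rmorphD /= !rmorph_sum /=.
rewrite !big1 ?addr0 // => i _; last first.
  by rewrite rmorphM rmorphXn /= mmapX mmap1U hX mulr0.
rewrite rmorph_sum /= big1 // => j ji.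
by rewrite !rmorphM /= !mmapX !mmap1U hXX ?mulr0.
Qed.

End Algebra.

Definition Abase (R S : comNzRingType) (m : nat) (c : posvec m)
    (f : {rmorphism R -> S}) : Aplus R c -> Aplus S c :=
  Aeval (@Acst S m c \o f) (@Agen S m c).

Lemma Abase_pi (R S : comNzRingType) m (c : posvec m) (f : {rmorphism R -> S})
  (p : {mpoly R[m]}) : Abase f (Api c p) = Api c (map_mpoly f p).
Proof.
rewrite /Abase Aeval_pi; last exact: Agen_rel.
rewrite /map_mpoly /mmap rmorph_sum /=; apply: eq_bigr => x _.
rewrite rmorphM /=; congr (_ * _); rewrite /mmap1 rmorph_prod.
by apply: eq_bigr => i _; rewrite rmorphXn.
Qed.

Definition Atorus (S : comNzRingType) (m : nat) (c : posvec m)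
    (lam : 'I_m -> S) : Aplus S c -> Aplus S c :=
  Aeval (@Acst S m c) (fun i => Acst c (lam i) * Agen S c i).

Lemma Atorus_pi (S : comNzRingType) m (c : posvec m) (lam : 'I_m -> S)
  (p : {mpoly S[m]}) :
  Atorus lam (Api c p) = Api c (p \mPo [tuple lam i *: 'X_i | i < m]).
Proof.
rewrite /Atorus Aeval_pi; last first.
  have [gX gXX] := Agen_rel S c; split=> [i | i j ji].
    by rewrite exprMn gX mulr0.
  by rewrite mulrACA gXX ?mulr0.
rewrite /comp_mpoly /mmap rmorph_sum /=; apply: eq_bigr => x _.
rewrite rmorphM /=; congr (_ * _); rewrite /mmap1 rmorph_prod.
apply: eq_bigr => i _; rewrite rmorphXn tnth_mktuple -mul_mpolyC.
by rewrite rmorphM.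
Qed.

(** [Aincl c I] sends [t_r] to [t_(i_r)], where [enum_val r] is the [r]-th
    smallest element [i_r] of [I]; its restriction to the ideal [Amax] is the
    inclusion [j_I]. *)
Definition Aincl (S : comNzRingType) (m : nat) (c : posvec m)
    (I : {set 'I_m}) : Aplus S (posvec_restr c I) -> Aplus S c :=
  Aeval (@Acst S m c) (fun r => Agen S c (enum_val r)).

Lemma Aincl_pi (S : comNzRingType) m (c : posvec m) (I : {set 'I_m})
  (p : {mpoly S[#|I|]}) :
  Aincl (Api (posvec_restr c I) p) =
  Api c (p \mPo [tuple 'X_(enum_val r) | r < #|I|]).
Proof.
have [gX gXX] := Agen_rel S c.
rewrite /Aincl Aeval_pi; last first.
  split=> [r | r s sr]; first exact: gX.
  by apply: gXX; rewrite (inj_eq enum_val_inj).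
rewrite /comp_mpoly /mmap rmorph_sum /=; apply: eq_bigr => x _.
rewrite rmorphM /=; congr (_ * _); rewrite /mmap1 rmorph_prod.
by apply: eq_bigr => i _; rewrite rmorphXn tnth_mktuple.
Qed.

Section Territory.
Variables (S : comNzRingType) (m : nat) (c : posvec m).
Implicit Types B : Aplus S c -> Prop.

Definition subalgebra B : Prop :=
  [/\ forall s, B (Acst c s),
      forall a b, B a -> B b -> B (a + b)
    & forall a b, B a -> B b -> B (a * b)].

(** The localization at [f] of the module [Aplus S c / B] is free of rank [g]
    over [S_f]: after clearing denominators a basis consists of the classes of
    [g] elements [e j]; the two clauses are generation and linear independence
    over [S_f]. *)
Definition quotient_free_at (g : nat) B (f : S) : Prop :=
  exists e : 'I_g -> Aplus S c,
    (forall a, exists (N : nat) (s : 'I_g -> S),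
       B (Acst c (f ^+ N) * a - \sum_j Acst c (s j) * e j)) /\
    (forall s : 'I_g -> S, B (\sum_j Acst c (s j) * e j) ->
       exists N : nat, forall j, f ^+ N * s j = 0).

(** Zariski-local freeness: the [D(f i)] cover the spectrum of [S]. *)
Definition quotient_locally_free (g : nat) B : Prop :=
  exists (n : nat) (f u : 'I_n -> S),
    \sum_i u i * f i = 1 /\ forall i, quotient_free_at g B (f i).

(** The points of [Ter^g_c] over the affine base [Spec S]. *)
Record Ter (g : nat) := MkTer {
  ter_set :> Aplus S c -> Prop;
  ter_subalgebra : subalgebra ter_set;
  ter_locally_free : quotient_locally_free g ter_set
}.

Definition same_set B B' : Prop := forall a, B a <-> B' a.

Definition span B : Aplus S c -> Prop := fun a =>
  exists (n : nat) (s : 'I_n -> S) (b : 'I_n -> Aplus S c),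
    (forall i, B (b i)) /\ a = \sum_i Acst c (s i) * b i.

Definition torus_act (lam : 'I_m -> S) B : Aplus S c -> Prop := fun a =>
  exists2 b, B b & a = Atorus lam b.

End Territory.

(** Pullback of a family of subalgebras along [Spec S -> Spec R]: as the
    quotient is flat, [B (x)_R S] is the [S]-submodule spanned by the image of
    [B]. *)
Definition base_change (R S : comNzRingType) (m : nat) (c : posvec m)
    (f : {rmorphism R -> S}) (B : Aplus R c -> Prop) : Aplus S c -> Prop :=
  span (fun a => exists2 b, B b & a = Abase f b).

Definition transverse_union (S : comNzRingType) (m : nat) (c : posvec m)
    (I I' : {set 'I_m}) (B1 : Aplus S (posvec_restr c I) -> Prop)
    (B2 : Aplus S (posvec_restr c I') -> Prop) : Aplus S c -> Prop := fun a =>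
  exists (s : S) (b1 : Aplus S (posvec_restr c I))
         (b2 : Aplus S (posvec_restr c I')),
    [/\ B1 b1 /\ Amax b1, B2 b2 /\ Amax b2
      & a = Acst c s + Aincl b1 + Aincl b2].

(** A homomorphism of group schemes from [G_m] to [(G_m)^m], given on
    [S]-points; the values at non-units are irrelevant. *)
Record one_param_subgroup (m : nat) := OneParam {
  ops :> forall S : comUnitRingType, S -> 'I_m -> S;
  ops_unit : forall (S : comUnitRingType) (x : S) i,
    x \is a GRing.unit -> ops x i \is a GRing.unit;
  ops_mul : forall (S : comUnitRingType) (x y : S) i,
    x \is a GRing.unit -> y \is a GRing.unit ->
    ops (x * y) i = ops x i * ops y i;
  ops_natural : forall (S S' : comUnitRingType) (f : {rmorphism S -> S'})
    (x : S) i, x \is a GRing.unit -> ops (f x) i = f (ops x i)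
}.

(** [F], a point over [A^1 = Spec k[x]], extends the family
    [lam |-> gamma lam . B] over [G_m]. The comparison over [G_m] is made on
    all its [S]-points, i.e. on ring maps [k[x] -> S] sending [x] to a unit. *)
Definition extends_orbit (k : fieldType) (m : nat) (c : posvec m) (g : nat)
    (gamma : one_param_subgroup m) (B : Ter k c g) (F : Ter {poly k} c g) :
    Prop :=
  forall (S : comUnitRingType) (f : {rmorphism {poly k} -> S}),
    f 'X \is a GRing.unit ->
    same_set (base_change f F)
      (torus_act (gamma S (f 'X)) (base_change (f \o polyC) B)).

(** [L] is the limit of [B] under [gamma]: the fibre at [x = 0]. *)
Definition is_limit (k : fieldType) (m : nat) (c : posvec m) (g : nat)
    (gamma : one_param_subgroup m) (B L : Ter k c g) : Prop :=
  exists F : Ter {poly k} c g,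
    extends_orbit gamma B F /\
    same_set (base_change (horner_eval (0 : k)) F) L.

(* Main.v *)
(** Let the one-parameter subgroup act with weight 1 on [t_i] for [i] in [I]
    and weight 0 for [i] in [I']. The monomials [t_i ^ a] are weight vectors,
    and among the families of [g] monomials that form a basis modulo [B] one of
    maximal total weight is chosen. By exchange, every monomial is then
    congruent modulo [B] to a combination of basis monomials of weight at least
    its own. Hence the same monomials are a basis modulo the ['X]-saturation of
    the orbit of [B] over [k['X]], so that this saturation is the flat
    extension of the orbit, and its fibre [L] at ['X = 0] is spanned by weight
    vectors. Weight 0 is [k + m_I'] and the positive weights make up [m_I], so
    [L] is the transverse union of its preimages in the two factors. *)

From HB Require Import structures.
From mathcomp Require Import all_boot all_algebra.
From mathcomp Require Import boolp mpoly.
Require Import Defs.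

Set Implicit Arguments.
Unset Strict Implicit.
Unset Printing Implicit Defensive.

Import GRing.Theory.
Local Open Scope ring_scope.

(** * Morphisms out of [Aplus] *)

Section Morphisms.
Variables (S : comNzRingType) (m : nat) (c : posvec m).

(** Every class has a polynomial representative, so constants and the [t_i] generate the ring. Ring
    morphisms out of it are compared in this way. *)
Lemma Aplus_ind (P : Aplus S c -> Prop) :
  (forall s, P (Acst c s)) -> (forall i, P (Agen S c i)) ->
  (forall a b, P a -> P b -> P (a + b)) ->
  (forall a b, P a -> P b -> P (a * b)) -> forall a, P a.
Proof.
move=> Pc Pg PD PM a.
have -> : a = Api c (repr a) by rewrite /Api reprK.
elim/mpolyind: (repr a) => [|s mn p _ _ Pp]; first exact: (Pc 0).
rewrite rmorphD; apply: (PD) => //; rewrite -mul_mpolyC rmorphM.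
apply: (PM); first exact: Pc.
rewrite mpolyXE_id rmorph_prod; apply: (big_ind P) => [||i _].
- by rewrite -(rmorph1 (Acst c)); apply: Pc.
- exact: PM.
- elim: (mn i) => [|n IHn].
    by rewrite rmorphXn expr0 -(rmorph1 (Acst c)); apply: Pc.
  by rewrite exprS rmorphM; apply: PM => //; apply: Pg.
Qed.

Lemma Aplus_morph_eq (T : comNzRingType) (u v : {rmorphism Aplus S c -> T}) :
  (forall s, u (Acst c s) = v (Acst c s)) ->
  (forall i, u (Agen S c i) = v (Agen S c i)) -> u =1 v.
Proof.
move=> uvc uvg; elim/Aplus_ind => // a b Ea Eb.
  by rewrite !rmorphD Ea Eb.
by rewrite !rmorphM Ea Eb.
Qed.

Section Eval.
Variables (T : comNzRingType) (f : {rmorphism S -> T}) (h : 'I_m -> T).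
Hypothesis hrel : respects_rel c h.

Let ApiK (a : Aplus S c) : Api c (repr a) = a.
Proof. by rewrite /Api reprK. Qed.

Lemma Aeval_is_zmod_morphism : zmod_morphism (@Aeval S m c T f h).
Proof.
by move=> a b; rewrite -[a]ApiK -[b]ApiK -rmorphB !Aeval_pi // rmorphB.
Qed.

Lemma Aeval_is_monoid_morphism : monoid_morphism (@Aeval S m c T f h).
Proof.
split=> [|a b]; first by rewrite -(rmorph1 (Api c)) Aeval_pi // rmorph1.
by rewrite -[a]ApiK -[b]ApiK -rmorphM !Aeval_pi // rmorphM.
Qed.

Lemma Aeval_cst s : Aeval f h (Acst c s) = f s.
Proof. by rewrite Aeval_pi // mmapC. Qed.

Lemma Aeval_gen i : Aeval f h (Agen S c i) = h i.
Proof. by rewrite Aeval_pi // mmapX mmap1U. Qed.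

End Eval.

Lemma Atorus_rel (lam : 'I_m -> S) :
  respects_rel c (fun i => Acst c (lam i) * Agen S c i).
Proof.
have [gX gXX] := Agen_rel S c; split=> [i | i j ji].
  by rewrite exprMn gX mulr0.
by rewrite mulrACA gXX ?mulr0.
Qed.

HB.instance Definition _ (lam : 'I_m -> S) :=
  GRing.isZmodMorphism.Build _ _ (@Atorus S m c lam)
    (Aeval_is_zmod_morphism (Acst c) (Atorus_rel lam)).
HB.instance Definition _ (lam : 'I_m -> S) :=
  GRing.isMonoidMorphism.Build _ _ (@Atorus S m c lam)
    (Aeval_is_monoid_morphism (Acst c) (Atorus_rel lam)).

Lemma Atorus_cst (lam : 'I_m -> S) s : Atorus lam (Acst c s) = Acst c s.
Proof. exact: (Aeval_cst (Acst c) (Atorus_rel lam)). Qed.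

Lemma Atorus_gen (lam : 'I_m -> S) i :
  Atorus lam (Agen S c i) = Acst c (lam i) * Agen S c i.
Proof. exact: (Aeval_gen (Acst c) (Atorus_rel lam)). Qed.

Lemma Aincl_rel (I : {set 'I_m}) :
  respects_rel (posvec_restr c I) (fun r => Agen S c (enum_val r)).
Proof.
have [gX gXX] := Agen_rel S c; split=> [r | r s sr]; first exact: gX.
by apply: gXX; rewrite (inj_eq enum_val_inj).
Qed.

End Morphisms.

Section MoreMorphisms.
Variables (S : comNzRingType) (m : nat) (c : posvec m) (I : {set 'I_m}).

HB.instance Definition _ :=
  GRing.isZmodMorphism.Build _ _ (@Aincl S m c I)
    (@Aeval_is_zmod_morphism _ _ _ _ (@Acst S m c) _ (Aincl_rel S c I)).
HB.instance Definition _ :=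
  GRing.isMonoidMorphism.Build _ _ (@Aincl S m c I)
    (@Aeval_is_monoid_morphism _ _ _ _ (@Acst S m c) _ (Aincl_rel S c I)).

Lemma Aincl_cst (s : S) : Aincl (Acst (posvec_restr c I) s) = Acst c s.
Proof. exact: (@Aeval_cst _ _ _ _ (@Acst S m c) _ (Aincl_rel S c I)). Qed.

Lemma Aincl_gen r :
  Aincl (Agen S (posvec_restr c I) r) = Agen S c (enum_val r).
Proof. exact: (@Aeval_gen _ _ _ _ (@Acst S m c) _ (Aincl_rel S c I)). Qed.

Variables (R : comNzRingType) (f : {rmorphism R -> S}).

HB.instance Definition _ :=
  GRing.isZmodMorphism.Build _ _ (@Abase R S m c f)
    (@Aeval_is_zmod_morphism _ _ _ _ (@Acst S m c \o f) _ (Agen_rel S c)).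
HB.instance Definition _ :=
  GRing.isMonoidMorphism.Build _ _ (@Abase R S m c f)
    (@Aeval_is_monoid_morphism _ _ _ _ (@Acst S m c \o f) _ (Agen_rel S c)).

Lemma Abase_cst s : Abase f (Acst c s) = Acst c (f s).
Proof. exact: (@Aeval_cst _ _ _ _ (@Acst S m c \o f) _ (Agen_rel S c)). Qed.

Lemma Abase_gen i : Abase f (Agen R c i) = Agen S c i.
Proof. exact: (@Aeval_gen _ _ _ _ (@Acst S m c \o f) _ (Agen_rel S c)). Qed.

Lemma Abase_torus (lam : 'I_m -> R) (a : Aplus R c) :
  Abase f (Atorus lam a) = Atorus (f \o lam) (Abase f a).
Proof.
apply: (@Aplus_morph_eq _ _ _ _ (@Abase R S m c f \o Atorus lam)
          (Atorus (f \o lam) \o @Abase R S m c f)) => [s|i] /=.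
  by rewrite Atorus_cst Abase_cst Atorus_cst.
by rewrite Atorus_gen rmorphM /= Abase_cst Abase_gen Atorus_gen.
Qed.

End MoreMorphisms.

Lemma Abase_comp (R S T : comNzRingType) (m : nat) (c : posvec m)
    (f : {rmorphism R -> S}) (h : {rmorphism S -> T}) (a : Aplus R c) :
  Abase h (Abase f a) = Abase (h \o f) a.
Proof.
apply: (@Aplus_morph_eq _ _ _ _ (@Abase S T m c h \o @Abase R S m c f)
          (@Abase R T m c (h \o f))) => [s|i] /=.
  by rewrite !Abase_cst.
by rewrite !Abase_gen.
Qed.

(** * Monomials spanning the algebra *)

Section Monomials.
Variables (S : comNzRingType) (m : nat) (c : posvec m) (n : nat).
Hypothesis m_gt0 : (0 < m)%N.
Hypothesis c_le : forall i, (c i <= n)%N.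

Definition Amon (j : 'I_m * 'I_n) : Aplus S c := Agen S c j.1 ^+ j.2.

(** These monomials span redundantly: [1] occurs once for each [i], and
    those with [c i <= a] vanish. *)
Lemma Amon_span (a : Aplus S c) :
  exists s : 'I_m * 'I_n -> S, a = \sum_j Acst c (s j) * Amon j.
Proof.
have [gX gXX] := Agen_rel S c.
pose P a := exists s : 'I_m * 'I_n -> S, a = \sum_j Acst c (s j) * Amon j.
have P0 : P 0.
  by exists (fun=> 0); rewrite big1 // => j _; rewrite rmorph0 mul0r.
have PD x y : P x -> P y -> P (x + y).
  move=> [s ->] [t ->]; exists (fun j => s j + t j); rewrite -big_split /=.
  by apply: eq_bigr => j _; rewrite rmorphD mulrDl.
have PZ s x : P x -> P (Acst c s * x).
  move=> [t ->]; exists (fun j => s * t j); rewrite mulr_sumr.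
  by apply: eq_bigr => j _; rewrite rmorphM mulrA.
have Psum (J : finType) (F : J -> Aplus S c) :
  (forall j, P (F j)) -> P (\sum_j F j) by move=> PF; apply: big_ind.
have Pmon j : P (Amon j).
  exists (fun l => (l == j)%:R); rewrite (bigD1 j) //= eqxx rmorph1 mul1r.
  by rewrite big1 ?addr0 // => l /negPf->; rewrite rmorph0 mul0r.
have Pexp i d : P (Agen S c i ^+ d).
  have [dn|nd] := ltnP d n; first exact: (Pmon (i, Ordinal dn)).
  by rewrite -(subnK (leq_trans (c_le i) nd)) exprD gX mulr0.
have P1 : P 1 by rewrite -(expr0 (Agen S c (Ordinal m_gt0))).
apply: (Aplus_ind (P := P)) => // [s|i|x y [s ->] [t ->]].
- by rewrite -[Acst c s]mulr1; apply: PZ.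
- by rewrite -[Agen S c i]expr1.
- rewrite mulr_suml; apply: (Psum) => -[i d]; rewrite -mulrA; apply: (PZ).
  rewrite mulr_sumr; apply: (Psum) => -[j e]; rewrite mulrCA; apply: (PZ).
  (* Powers of one variable multiply to a power; positive powers of distinct variables multiply to
     zero. *)
  rewrite /Amon /=; have [->|ji] := eqVneq j i; first by rewrite -exprD.
  case: (nat_of_ord d) => [|d']; first by rewrite mul1r.
  case: (nat_of_ord e) => [|e']; first by rewrite mulr1.
  by rewrite exprSr exprS mulrA -(mulrA _ (Agen S c i)) gXX // mulr0 mul0r.
Qed.

End Monomials.
Arguments Amon S {m} c {n} j.

(** * Submodules and base change *)

Section Submodules.
Variables (S : comNzRingType) (m : nat) (c : posvec m).
Implicit Types B : Aplus S c -> Prop.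

Lemma subalgebra0 B : subalgebra B -> B 0.
Proof. by case=> Bc _ _; rewrite -(rmorph0 (Acst c)); apply: Bc. Qed.

Lemma subalgebraZ B s a : subalgebra B -> B a -> B (Acst c s * a).
Proof. by case=> Bc _ BM Ba; apply: BM. Qed.

Lemma subalgebraB B a b : subalgebra B -> B a -> B b -> B (a - b).
Proof.
move=> sB Ba Bb; case: (sB) => _ BD _; apply: BD => //.
by rewrite -mulN1r -(rmorph1 (Acst c)) -rmorphN; apply: subalgebraZ.
Qed.

Lemma subalgebra_sum B (J : finType) (F : J -> Aplus S c) :
  subalgebra B -> (forall j, B (F j)) -> B (\sum_j F j).
Proof.
move=> sB BF; apply: (big_ind B) => //; first exact: subalgebra0.
by case: sB.
Qed.

Lemma span_sub B a : B a -> span B a.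
Proof.
move=> Ba; exists 1%N, (fun=> 1), (fun=> a); split=> //.
by rewrite big_ord1 rmorph1 mul1r.
Qed.

Lemma span_ind B (P : Aplus S c -> Prop) :
  P 0 -> (forall a, B a -> P a) -> (forall a b, P a -> P b -> P (a + b)) ->
  (forall s a, P a -> P (Acst c s * a)) -> forall a, span B a -> P a.
Proof.
move=> P0 PB PD PZ _ [n [s [b [Bb ->]]]].
by apply: (big_ind P) => // i _; apply: PZ; apply: PB.
Qed.

Lemma span0 B : span B 0.
Proof.
by exists 0%N, (fun=> 0), (fun=> 0); split=> [[]//|]; rewrite big_ord0.
Qed.

Lemma spanZ B s a : span B a -> span B (Acst c s * a).
Proof.
move=> [n [t [b [Bb ->]]]]; exists n, (fun i => s * t i), b; split=> //.
by rewrite mulr_sumr; apply: eq_bigr => i _; rewrite rmorphM mulrA.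
Qed.

Lemma spanD B a b : span B a -> span B b -> span B (a + b).
Proof.
move=> [n [s [x [Bx ->]]]] [p [t [y [By ->]]]].
exists (n + p)%N, (fun i => match split i with inl j => s j | inr j => t j end).
exists (fun i => match split i with inl j => x j | inr j => y j end).
split=> [i|]; first by case: (split i).
rewrite big_split_ord /=; congr (_ + _); apply: eq_bigr => i _.
  by rewrite -[lshift p i]/(unsplit (inl i)) unsplitK.
by rewrite -[rshift n i]/(unsplit (inr i)) unsplitK.
Qed.

Lemma span_subalgebra B :
  B 1 -> (forall a b, B a -> B b -> B (a * b)) -> subalgebra (span B).
Proof.
move=> B1 BM; split=> [s|a b|a b Sa Sb].
- by rewrite -[Acst c s]mulr1; apply/spanZ/span_sub.
- exact: spanD.
- move: a Sa; apply: span_ind => [|a Ba|a a' Sa Sa'|s a Sa].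
  + by rewrite mul0r; apply: span0.
  + move: b Sb; apply: span_ind => [|b Bb|b b' Sb Sb'|s b Sb].
    * by rewrite mulr0; apply: span0.
    * exact/span_sub/BM.
    * by rewrite mulrDr; apply: spanD.
    * by rewrite mulrCA; apply: spanZ.
  + by rewrite mulrDl; apply: spanD.
  + by rewrite -mulrA; apply: spanZ.
Qed.

End Submodules.

Section BaseChange.
Variables (R S : comNzRingType) (m : nat) (c : posvec m).
Variables (f : {rmorphism R -> S}) (B : Aplus R c -> Prop).

Lemma base_change_image b : B b -> base_change f B (Abase f b).
Proof. by move=> Bb; apply: span_sub; exists b. Qed.

Lemma base_change_subalgebra : subalgebra B -> subalgebra (base_change f B).
Proof.
case=> Bc _ BM; apply: span_subalgebra => [|a b].
  exists (Acst c 1); first exact: Bc.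
  by rewrite !rmorph1.
move=> [x Bx ->] [y By ->]; exists (x * y); first exact: BM.
by rewrite rmorphM.
Qed.

End BaseChange.

(** * Bases of maximal weight *)

(** Steinitz exchange: the new matrix is [E *m M], where [E] is the identity with row [r0] replaced
    by [a], and [E] is invertible because its entry [a 0 r0] on the diagonal is nonzero. *)
Lemma rowsub_exchange_unitmx (k : fieldType) (g : nat) (X : Type)
    (v : X -> 'rV[k]_g) (l : 'I_g -> X) (j : X) (a : 'rV[k]_g) (r0 : 'I_g) :
  \matrix_r v (l r) \in unitmx -> v j = a *m \matrix_r v (l r) ->
  a 0 r0 != 0 -> \matrix_r v (if r == r0 then j else l r) \in unitmx.
Proof.
move=> Uv vj a0; rewrite -row_free_unit -kermx_eq0; apply/rowV0P => u.
move/sub_kermxP.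
set M := \matrix_r v (l r) in Uv vj.
set E : 'M[k]_g := \matrix_r (if r == r0 then a else delta_mx 0 r).
have -> : \matrix_r v (if r == r0 then j else l r) = E *m M.
  apply/row_matrixP => r; rewrite row_mul !rowK; case: eqP => // _.
  by rewrite -rowE rowK.
rewrite mulmxA => uEM0.
have uE0 : u *m E = 0 by rewrite -(mulmxK Uv (u *m E)) uEM0 mul0mx.
have uE s : (u *m E) 0 s = u 0 r0 * a 0 s + (s != r0)%:R * u 0 s.
  rewrite mxE (bigD1 r0) //= mxE eqxx; congr (_ + _).
  rewrite (eq_bigr (fun r => u 0 r * (r == s)%:R)); last first.
    by move=> r /negPf rr0; rewrite mxE rr0 mxE eqxx eq_sym.
  have [->|sr0] := eqVneq s r0.
    by rewrite mul0r big1 // => r /negPf->; rewrite mulr0.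
  rewrite (bigD1 s) //= eqxx mulr1 mul1r big1 ?addr0 // => r /andP[_ /negPf->].
  exact: mulr0.
have u0 : u 0 r0 = 0.
  have := uE r0; rewrite uE0 mxE eqxx mul0r addr0 => /esym/eqP.
  by rewrite mulf_eq0 (negPf a0) orbF => /eqP.
apply/rowP => s; have := uE s; rewrite uE0 u0 mul0r add0r !mxE.
by have [->|_] := eqVneq s r0; rewrite ?mul1r.
Qed.

(** A basis of maximal total weight: if a vector of larger weight occurred in
    the expansion of [v j], exchanging would increase the total weight. *)
Lemma heaviest_row_basis (k : fieldType) (g : nat) (X : finType)
    (v : X -> 'rV[k]_g) (w : X -> nat) :
  (forall u, exists s : X -> k, u = \sum_j s j *: v j) ->
  exists l : 'I_g -> X, \matrix_r v (l r) \in unitmx /\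
    forall j (a : 'rV[k]_g) r, v j = a *m \matrix_r v (l r) ->
      a 0 r != 0 -> (w j <= w (l r))%N.
Proof.
move=> vspan.
pose M : 'M[k]_(#|X|, g) := \matrix_i v (enum_val i).
have Mfull : row_full M.
  rewrite -sub1mx; apply/row_subP => r; have [s ->] := vspan (row r 1%:M).
  apply: summx_sub => j _; apply: scalemx_sub.
  by rewrite -(enum_rankK j) -(rowK (fun i => v (enum_val i))) row_sub.
pose U (l : {ffun 'I_g -> X}) := \matrix_r v (l r) \in unitmx.
(* Since the [v j] span, [g] independent rows can be selected, so the maximum is taken over a
   nonempty set. *)
have Ul0 : U [ffun r => enum_val (fullrankfun Mfull r)].
  have := fullrowsub_unit Mfull; rewrite /U; congr (_ \in unitmx).
  by apply/row_matrixP => r; rewrite row_rowsub !rowK [in RHS]ffunE.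
have [l Ul lmax] :=
  arg_maxnP (fun l : {ffun 'I_g -> X} => \sum_r w (l r))%N Ul0.
exists l; split=> // j a r vj ar0; rewrite leqNgt; apply/negP => lt_w.
have /= := lmax [ffun s => if s == r then j else l s].
have -> : U [ffun s => if s == r then j else l s].
  have := rowsub_exchange_unitmx Ul vj ar0; rewrite /U; congr (_ \in unitmx).
  by apply/matrixP => s t; rewrite !mxE ffunE.
move/(_ isT); rewrite leqNgt => /negP; apply.
rewrite (bigD1 r) //= [ltnRHS](bigD1 r) //= ffunE eqxx.
rewrite [X in (_ < _ + X)%N](eq_bigr (fun s => w (l s))).
  by rewrite ltn_add2r.
by move=> s /negPf sr; rewrite ffunE sr.
Qed.

Section FieldCodim.
Variables (k : fieldType) (m : nat) (c : posvec m) (g : nat) (B : Ter k c g).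

Let sB := ter_subalgebra B.

(** Some [f i] of the cover is nonzero, hence invertible in [k], so localizing there changes nothing
    and denominators can be divided out. *)
Lemma Ter_field_basis :
  exists e : 'I_g -> Aplus k c,
    (forall a, exists s : 'rV[k]_g, B (a - \sum_j Acst c (s 0 j) * e j)) /\
    (forall s : 'rV[k]_g, B (\sum_j Acst c (s 0 j) * e j) -> s = 0).
Proof.
have [n [f [u [uf1 Bfree]]]] := ter_locally_free B.
have [i fi] : exists i, f i != 0.
  apply/existsP; apply: contraT; rewrite negb_exists => /forallP f0.
  have := oner_neq0 k; rewrite -uf1 big1 ?eqxx // => i _.
  by rewrite (eqP (negPn (f0 i))) mulr0.
have [e [egen eind]] := Bfree i; exists e; split=> [a|s Bs].
  have [N [s Bs]] := egen a; exists (\row_j (f i ^- N * s j)).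
  have := subalgebraZ (f i ^- N) sB Bs.
  rewrite mulrBr mulrA -rmorphM mulVf ?expf_neq0 // rmorph1 mul1r mulr_sumr.
  congr (B (_ - _)); apply: eq_bigr => j _.
  by rewrite mxE rmorphM mulrA.
have [N Ns] := eind (fun j => s 0 j) Bs; apply/rowP => j; rewrite mxE.
by apply/eqP; have/eqP := Ns j; rewrite mulf_eq0 expf_eq0 (negPf fi) andbF.
Qed.

(** Coordinates in a basis identify the quotient with ['rV[k]_g]; with [B] as the kernel of [phi],
    questions about bases modulo [B] become questions about matrices. *)
Lemma Ter_field_functional :
  exists phi : Aplus k c -> 'rV[k]_g,
    [/\ forall s a b, phi (Acst c s * a + b) = s *: phi a + phi b,
        forall a, B a <-> phi a = 0
      & forall u, exists a, phi a = u].
Proof.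
have [e [egen eind]] := Ter_field_basis.
have [phi phiP] := choice egen.
have uniq a (s : 'rV[k]_g) : B (a - \sum_j Acst c (s 0 j) * e j) -> phi a = s.
  move=> Bs; apply/eqP; rewrite -subr_eq0; apply/eqP/eind.
  have := subalgebraB sB Bs (phiP a).
  rewrite opprB addrC addrA subrK -sumrB; congr (B _); apply: eq_bigr => j _.
  by rewrite !mxE rmorphB mulrBl.
exists phi; split=> [s a b|a|u].
- apply: uniq; have := subalgebraZ s sB (phiP a).
  case: sB => _ BD _ /BD/(_ (phiP b)); congr (B _).
  rewrite mulrBr addrACA -opprD mulr_sumr -big_split /=; congr (_ - _).
  by apply: eq_bigr => j _; rewrite !mxE rmorphD rmorphM mulrDl mulrA.
- split=> [Ba|phi0]; last first.
    have := phiP a; rewrite phi0 big1 ?subr0 // => j _.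
    by rewrite mxE rmorph0 mul0r.
  apply: uniq; rewrite big1 ?subr0 // => j _.
  by rewrite mxE rmorph0 mul0r.
- exists (\sum_j Acst c (u 0 j) * e j); apply: uniq.
  by rewrite subrr; apply: subalgebra0.
Qed.

(** [phi] carries expansions modulo [B] to identities of rows, so [heaviest_row_basis] applies to
    the rows [phi (e j)]; the [a j r] are their coordinates in the selected basis. *)
Lemma heaviest_basis (X : finType) (e : X -> Aplus k c) (w : X -> nat) :
  (forall a, exists s : X -> k, a = \sum_j Acst c (s j) * e j) ->
  exists (l : 'I_g -> X) (a : X -> 'I_g -> k),
    [/\ forall j, B (e j - \sum_r Acst c (a j r) * e (l r)),
        forall s : 'I_g -> k, B (\sum_r Acst c (s r) * e (l r)) ->
          forall r, s r = 0
      & forall j r, a j r != 0 -> (w j <= w (l r))%N].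
Proof.
move=> espan; have [phi [phiL phiB phi_surj]] := Ter_field_functional.
have phi0 : phi 0 = 0 by apply/phiB; apply: subalgebra0 sB.
have phi_sum (J : finType) (s : J -> k) (x : J -> Aplus k c) :
    phi (\sum_j Acst c (s j) * x j) = \sum_j s j *: phi (x j).
  by elim/big_rec2: _ => // j y z _ <-; rewrite phiL.
have [|l [Ul lw]] := @heaviest_row_basis k g X (phi \o e) w.
  move=> u; have [a <-] := phi_surj u; have [s ->] := espan a.
  by exists s; rewrite phi_sum.
set M := (X in X \in unitmx) in Ul lw.
have comb (s : 'I_g -> k) :
    phi (\sum_r Acst c (s r) * e (l r)) = (\row_r s r) *m M.
  rewrite phi_sum mulmx_sum_row; apply: eq_bigr => r _.
  by rewrite rowK mxE.
exists l, (fun j r => (phi (e j) *m invmx M) 0 r); split=> [j|s|j r].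
- apply/phiB; rewrite addrC -mulN1r -(rmorph1 (Acst c)) -rmorphN phiL comb.
  have -> : \row_r (phi (e j) *m invmx M) 0 r = phi (e j) *m invmx M.
    by apply/rowP => r; rewrite mxE.
  by rewrite mulmxKV // scaleN1r addNr.
- move/phiB; rewrite comb => sM0 r.
  have := mulmxK Ul (\row_r s r); rewrite sM0 mul0mx => /rowP/(_ r).
  by rewrite !mxE.
- by apply: lw; rewrite mulmxKV.
Qed.

End FieldCodim.

(** * Constant families over the affine line *)

Section PolynomialRing.
Variables (R : comNzRingType) (m : nat) (c : posvec m).

Lemma Agen_polyC_rel : respects_rel c (fun i => (Agen R c i)%:P).
Proof.
have [gX gXX] := Agen_rel R c; split=> [i | i j ji].
  by rewrite -rmorphXn /= gX.
by rewrite -rmorphM /= gXX.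
Qed.

(** The identification of [A_c] over [R[X]] with polynomials over [A_c], through which membership in
    a constant family is read off coefficientwise. *)
Definition Apoly : Aplus {poly R} c -> {poly Aplus R c} :=
  Aeval (map_poly (@Acst R m c)) (fun i => (Agen R c i)%:P).

HB.instance Definition _ :=
  GRing.isZmodMorphism.Build _ _ Apoly
    (Aeval_is_zmod_morphism (map_poly (@Acst R m c)) Agen_polyC_rel).
HB.instance Definition _ :=
  GRing.isMonoidMorphism.Build _ _ Apoly
    (Aeval_is_monoid_morphism (map_poly (@Acst R m c)) Agen_polyC_rel).

Lemma Apoly_cst p : Apoly (Acst c p) = map_poly (@Acst R m c) p.
Proof. exact: (Aeval_cst (map_poly (@Acst R m c)) Agen_polyC_rel). Qed.

Lemma Apoly_gen i : Apoly (Agen {poly R} c i) = (Agen R c i)%:P.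
Proof. exact: (Aeval_gen (map_poly (@Acst R m c)) Agen_polyC_rel). Qed.

Lemma Apoly_base a : Apoly (Abase polyC a) = a%:P.
Proof.
apply: (@Aplus_morph_eq _ _ _ _ (Apoly \o @Abase _ _ m c polyC) polyC).
  by move=> s; rewrite /= Abase_cst Apoly_cst map_polyC.
by move=> i; rewrite /= Abase_gen Apoly_gen.
Qed.

(** The generators [Abase polyC b] become constant polynomials, and scalars from [{poly R}] only
    form [R]-linear combinations of coefficients, under which [B] is stable. *)
Lemma coef_base_change (B : Aplus R c -> Prop) b n :
  subalgebra B -> base_change polyC B b -> B (Apoly b)`_n.
Proof.
move=> sB Bb; move: b Bb n; apply: span_ind => [n|_ [b Bb ->] n|a b Ba Bb n|].
- by rewrite rmorph0 coef0; apply: subalgebra0 sB.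
- by rewrite Apoly_base coefC; case: eqP => // _; apply: subalgebra0 sB.
- by rewrite rmorphD coefD; case: sB => _ BD _; apply: BD.
- move=> s a Ba n; rewrite rmorphM /= Apoly_cst coefM.
  apply: subalgebra_sum => // i; rewrite coef_map.
  exact: subalgebraZ.
Qed.

(** The coefficients of degree [n] in a relation over [{poly R}] form a relation over [R] modulo
    [B]. *)
Lemma free_base_change (B : Aplus R c -> Prop) g (e : 'I_g -> Aplus R c) :
  subalgebra B ->
  (forall s : 'I_g -> R, B (\sum_r Acst c (s r) * e r) -> forall r, s r = 0) ->
  forall s : 'I_g -> {poly R},
    base_change polyC B (\sum_r Acst c (s r) * Abase polyC (e r)) ->
    forall r, s r = 0.
Proof.
move=> sB eind s Bs r; apply/polyP => n; rewrite coef0.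
apply: (eind (fun r => (s r)`_n)); have := coef_base_change n sB Bs.
congr (B _); rewrite rmorph_sum coef_sum; apply: eq_bigr => i _.
by rewrite rmorphM /= Apoly_cst Apoly_base coefMC coef_map.
Qed.

End PolynomialRing.

(** * The weight grading and the torus action *)

Section Grading.
Variables (R : comNzRingType) (m : nat) (c : posvec m) (wt : 'I_m -> nat).
Variable n : nat.
Hypothesis m_gt0 : (0 < m)%N.
Hypothesis c_le : forall i, (c i <= n)%N.

Definition mon_weight (j : 'I_m * 'I_n) : nat := (wt j.1 * j.2)%N.

Lemma Atorus_mon (x : R) (j : 'I_m * 'I_n) :
  Atorus (fun i => x ^+ wt i) (Amon R c j) =
  Acst c (x ^+ mon_weight j) * Amon R c j.
Proof. by rewrite rmorphXn /= Atorus_gen exprMn -rmorphXn /= -exprM. Qed.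

Lemma Agrading_rel : respects_rel c (fun i => Agen R c i *: 'X^(wt i)).
Proof.
have [gX gXX] := Agen_rel R c; split=> [i | i j ji].
  by rewrite exprZn gX scale0r.
by rewrite -scalerAl -scalerAr scalerA gXX // scale0r.
Qed.

(** The coaction of [G_m] with weights [wt]: the coefficient of ['X^d] is the homogeneous component
    of weight [d]. *)
Definition Agrading : Aplus R c -> {poly Aplus R c} :=
  Aeval (polyC \o @Acst R m c) (fun i => Agen R c i *: 'X^(wt i)).

HB.instance Definition _ :=
  GRing.isZmodMorphism.Build _ _ Agrading
    (Aeval_is_zmod_morphism (polyC \o @Acst R m c) Agrading_rel).
HB.instance Definition _ :=
  GRing.isMonoidMorphism.Build _ _ Agrading
    (Aeval_is_monoid_morphism (polyC \o @Acst R m c) Agrading_rel).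

Lemma Agrading_mon s (j : 'I_m * 'I_n) :
  Agrading (Acst c s * Amon R c j) =
  (Acst c s * Amon R c j) *: 'X^(mon_weight j).
Proof.
rewrite rmorphM rmorphXn /= /Agrading.
rewrite (Aeval_cst (polyC \o @Acst R m c) Agrading_rel).
rewrite (Aeval_gen (polyC \o @Acst R m c) Agrading_rel) /=.
by rewrite mul_polyC exprZn scalerA -exprM.
Qed.

(** The torus element of weights [W - w], which inverts that of weights [w] up
    to [x ^+ W]; unlike the latter it is only linear. *)
Definition Aflip (W : nat) (x : R) (a : Aplus R c) : Aplus R c :=
  \sum_(d < W.+1) Acst c (x ^+ (W - d)) * (Agrading a)`_d.

Lemma Aflip_sum (W : nat) (x : R) (J : finType) (s : J -> R)
    (l : J -> 'I_m * 'I_n) :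
  (forall j, (mon_weight (l j) <= W)%N) ->
  Aflip W x (\sum_j Acst c (s j) * Amon R c (l j)) =
  \sum_j Acst c (s j * x ^+ (W - mon_weight (l j))) * Amon R c (l j).
Proof.
move=> lW; rewrite /Aflip.
under eq_bigr => d _ do rewrite rmorph_sum coef_sum mulr_sumr.
rewrite exchange_big /=; apply: eq_bigr => j _.
have jW : (mon_weight (l j) < W.+1)%N by rewrite ltnS.
(* Only the degree equal to the weight of the monomial contributes; the bound [W] keeps it in
   range. *)
rewrite (bigD1 (Ordinal jW)) //= Agrading_mon coefZ coefXn eqxx mulr1.
rewrite [X in _ + X]big1 ?addr0 => [|d dj].
  by rewrite mulrA -rmorphM [x ^+ _ * _]mulrC.
by rewrite coefZ coefXn -[_ == _]/(d == Ordinal jW) (negPf dj) !mulr0.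
Qed.

(** The weights [w] and [W - w] add up to [W] on every monomial. This undoes the torus action
    without inverting [x], as is required over [{poly k}], where ['X] is not a unit. *)
Lemma Aflip_torus (W : nat) (x : R) (a : Aplus R c) :
  (forall j, (mon_weight j <= W)%N) ->
  Aflip W x (Atorus (fun i => x ^+ wt i) a) = Acst c (x ^+ W) * a.
Proof.
move=> jW; have [s ->] := Amon_span m_gt0 c_le a.
rewrite rmorph_sum mulr_sumr.
under eq_bigr => j _ do
  rewrite rmorphM /= Atorus_cst Atorus_mon mulrA -rmorphM.
rewrite (@Aflip_sum W x _ (fun j => s j * x ^+ mon_weight j) id) //.
apply: eq_bigr => j _; rewrite -mulrA -exprD subnKC // mulrA -rmorphM.
by rewrite [s j * _]mulrC.
Qed.

End Grading.

(** * The closure of an orbit *)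

Section WeightSubgroup.
Variables (m : nat) (wt : 'I_m -> nat).

Lemma weight_subgroup_unit (S : comUnitRingType) (x : S) (i : 'I_m) :
  x \is a GRing.unit -> x ^+ wt i \is a GRing.unit.
Proof. exact: unitrX. Qed.

Lemma weight_subgroup_mul (S : comUnitRingType) (x y : S) (i : 'I_m) :
  x \is a GRing.unit -> y \is a GRing.unit ->
  (x * y) ^+ wt i = x ^+ wt i * y ^+ wt i.
Proof. by rewrite exprMn. Qed.

Lemma weight_subgroup_natural (S S' : comUnitRingType)
    (f : {rmorphism S -> S'}) (x : S) (i : 'I_m) :
  x \is a GRing.unit -> f x ^+ wt i = f (x ^+ wt i).
Proof. by rewrite rmorphXn. Qed.

Definition weight_subgroup : one_param_subgroup m :=
  OneParam weight_subgroup_unit weight_subgroup_mul weight_subgroup_natural.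

End WeightSubgroup.

Section OrbitClosure.
Variables (k : fieldType) (m : nat) (c : posvec m) (wt : 'I_m -> nat).
Variable B : Aplus k c -> Prop.
Hypothesis sB : subalgebra B.

Let gX : 'I_m -> {poly k} := fun i => 'X ^+ wt i.

(** The ['X]-saturation makes the quotient flat over [A^1]. *)
Definition orbit_closure (a : Aplus {poly k} c) : Prop :=
  exists N b, base_change polyC B b /\ Acst c ('X ^+ N) * a = Atorus gX b.

Lemma orbit_closure_torus b :
  base_change polyC B b -> orbit_closure (Atorus gX b).
Proof. by move=> Bb; exists 0%N, b; rewrite expr0 rmorph1 mul1r. Qed.

Lemma orbit_closure_sat N a :
  orbit_closure (Acst c ('X ^+ N) * a) -> orbit_closure a.
Proof.
by move=> [M [b [Bb E]]]; exists (M + N)%N, b; rewrite exprD rmorphM -mulrA.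
Qed.

(** Two elements are brought to the common power ['X ^+ (N + M)]: sums cross-multiply as fractions
    do, and products multiply the two witnesses. *)
Lemma orbit_closure_subalgebra : subalgebra orbit_closure.
Proof.
have sBX := base_change_subalgebra polyC sB.
have [BXc BXD BXM] := sBX.
split=> [s|a b|a b].
- rewrite -(Atorus_cst c gX); apply: orbit_closure_torus.
  exact: BXc.
- move=> [N [x [Bx Ea]]] [M [y [By Eb]]].
  exists (N + M)%N, (Acst c ('X ^+ M) * x + Acst c ('X ^+ N) * y); split.
    by apply: BXD; apply: subalgebraZ.
  rewrite rmorphD !rmorphM /= !Atorus_cst -Ea -Eb exprD rmorphM.
  by rewrite mulrDr !mulrA [Acst c ('X ^+ M) * _]mulrC.
- move=> [N [x [Bx Ea]]] [M [y [By Eb]]].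
  exists (N + M)%N, (x * y); split; first exact: BXM.
  by rewrite rmorphM /= -Ea -Eb mulrACA -rmorphM -exprD.
Qed.

Lemma base_change_polyC_comp (S : comNzRingType) (f : {rmorphism {poly k} -> S})
    (b : Aplus {poly k} c) :
  base_change polyC B b -> base_change (f \o polyC) B (Abase f b).
Proof.
move: b; apply: span_ind => [|_ [b Bb ->]|a b Sa Sb|s a Sa].
- by rewrite rmorph0; apply: span0.
- by rewrite Abase_comp; apply: base_change_image.
- by rewrite rmorphD; apply: spanD.
- by rewrite rmorphM /= Abase_cst; apply: spanZ.
Qed.

(** Where [f 'X] is a unit, the power of ['X] allowed by the saturation can be divided out, so the
    closure agrees with the orbit over [G_m]. *)
Lemma orbit_closure_extends (S : comUnitRingType)
    (f : {rmorphism {poly k} -> S}) :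
  f 'X \is a GRing.unit ->
  same_set (base_change f orbit_closure)
    (torus_act (weight_subgroup wt S (f 'X)) (base_change (f \o polyC) B)).
Proof.
move=> Uf; set lam := ops (weight_subgroup _) _.
have lamE : f \o gX = lam by apply/funext => i; rewrite /= rmorphXn.
move=> a; split.
- move: a; apply: span_ind => [|_ [a [N [b [Bb E]]] ->]|a b|s a].
  + by exists 0; [apply: span0 | rewrite rmorph0].
  + exists (Acst c (f 'X ^- N) * Abase f b).
      exact/spanZ/base_change_polyC_comp.
    rewrite rmorphM /= Atorus_cst -lamE -Abase_torus -E rmorphM /= Abase_cst.
    by rewrite mulrA -rmorphM rmorphXn mulVr ?rmorph1 ?mul1r ?unitrX.
  + move=> [x Bx ->] [y By ->]; exists (x + y); first exact: spanD.
    by rewrite rmorphD.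
  + move=> [x Bx ->]; exists (Acst c s * x); first exact: spanZ.
    by rewrite rmorphM /= Atorus_cst.
- move=> [b Bb ->] {a}; move: b Bb.
  apply: span_ind => [|_ [b Bb ->]|a b Sa Sb|s a Sa].
  + by rewrite rmorph0; apply: span0.
  + rewrite -Abase_comp -lamE -Abase_torus; apply: base_change_image.
    exact/orbit_closure_torus/base_change_image.
  + by rewrite rmorphD; apply: spanD.
  + by rewrite rmorphM /= Atorus_cst; apply: spanZ.
Qed.

End OrbitClosure.

(** * Local freeness from a global basis *)

Section FreeQuotient.
Variables (S : comNzRingType) (m : nat) (c : posvec m) (g : nat).

(** A global basis serves on the cover by the single open set [D(1)], where no denominators
    occur. *)
Lemma quotient_free_locally_free (B : Aplus S c -> Prop)
    (e : 'I_g -> Aplus S c) :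
  (forall a, exists s : 'I_g -> S, B (a - \sum_j Acst c (s j) * e j)) ->
  (forall s : 'I_g -> S, B (\sum_j Acst c (s j) * e j) -> forall j, s j = 0) ->
  quotient_locally_free g B.
Proof.
move=> egen eind; exists 1%N, (fun=> 1), (fun=> 1); split.
  by rewrite big_ord1 mulr1.
move=> _; exists e; split=> [a|s /eind s0]; last first.
  by exists 0%N => j; rewrite s0 mulr0.
by have [s Bs] := egen a; exists 0%N, s; rewrite expr0 rmorph1 mul1r.
Qed.

Lemma quotient_gen_of_span (B : Aplus S c -> Prop) (X : finType)
    (x : X -> Aplus S c) (e : 'I_g -> Aplus S c) :
  subalgebra B ->
  (forall a, exists s : X -> S, a = \sum_j Acst c (s j) * x j) ->
  (forall j, exists s : 'I_g -> S, B (x j - \sum_r Acst c (s r) * e r)) ->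
  forall a, exists s : 'I_g -> S, B (a - \sum_r Acst c (s r) * e r).
Proof.
move=> sB xspan /choice[s Bs] a; have [t ->] := xspan a.
exists (fun r => \sum_j t j * s j r).
have /= := subalgebra_sum sB (fun j => subalgebraZ (t j) sB (Bs j)).
congr (B _); under eq_bigr => j _ do rewrite mulrBr mulr_sumr.
rewrite sumrB exchange_big /=; congr (_ - _); apply: eq_bigr => r _.
rewrite rmorph_sum mulr_suml; apply: eq_bigr => j _.
by rewrite rmorphM mulrA.
Qed.

End FreeQuotient.

Lemma Abase_mon (R S : comNzRingType) (m : nat) (c : posvec m) (n : nat)
    (f : {rmorphism R -> S}) (j : 'I_m * 'I_n) :
  Abase f (Amon R c j) = Amon S c j.
Proof. by rewrite rmorphXn /= Abase_gen. Qed.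

Lemma Abase_comb (R S : comNzRingType) (m : nat) (c : posvec m) (n : nat)
    (f : {rmorphism R -> S}) (J : finType) (s : J -> R)
    (l : J -> 'I_m * 'I_n) :
  Abase f (\sum_j Acst c (s j) * Amon R c (l j)) =
  \sum_j Acst c (f (s j)) * Amon S c (l j).
Proof.
rewrite rmorph_sum; apply: eq_bigr => j _.
by rewrite rmorphM /= Abase_cst Abase_mon.
Qed.

(** * The fibre of the orbit closure at zero *)

Section Limit.
Variables (k : fieldType) (m : nat) (c : posvec m) (wt : 'I_m -> nat).
Variables (n : nat) (B : Aplus k c -> Prop).
Hypothesis m_gt0 : (0 < m)%N.
Hypothesis c_le : forall i, (c i <= n)%N.
Hypothesis sB : subalgebra B.

Let w : 'I_m * 'I_n -> nat := mon_weight wt (n := n).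
Let F := orbit_closure wt B.
Let L := base_change (horner_eval (0 : k)) F.
Let sF : subalgebra F := orbit_closure_subalgebra wt sB.
Let sL : subalgebra L := base_change_subalgebra _ sF.

Variables (g : nat) (l : 'I_g -> 'I_m * 'I_n).

(** The torus multiplies each monomial by ['X] to its weight. The basis monomials that occur weigh
    at least [w j], so ['X ^+ w j] factors out of the transported relation and the saturation
    cancels it. *)
Lemma orbit_closure_relation j (a : 'I_g -> k) :
  B (Amon k c j - \sum_r Acst c (a r) * Amon k c (l r)) ->
  (forall r, a r != 0 -> (w j <= w (l r))%N) ->
  F (Amon _ c j
     - \sum_r Acst c (a r *: 'X^(w (l r) - w j)) * Amon _ c (l r)).
Proof.
move=> Bj wj; apply: (@orbit_closure_sat _ _ _ _ _ (w j)).
have := orbit_closure_torus wt (base_change_image polyC Bj).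
congr (orbit_closure _ _ _); rewrite rmorphB rmorph_sum rmorphB rmorph_sum.
rewrite /= Abase_mon Atorus_mon mulrBr mulr_sumr; congr (_ - _).
apply: eq_bigr => r _; rewrite !rmorphM /= Abase_cst Abase_mon Atorus_cst.
rewrite Atorus_mon !mulrA -!rmorphM; congr (Acst _ _ * _).
(* A vanishing coefficient comes without a weight bound, but then both sides are zero. *)
have [->|ar] := eqVneq (a r) 0; first by rewrite scale0r mulr0 mul0r.
by rewrite -scalerAr -exprD subnKC ?wj // mul_polyC.
Qed.

Hypothesis l_free : forall s : 'I_g -> k,
  B (\sum_r Acst c (s r) * Amon k c (l r)) -> forall r, s r = 0.

(** [Aflip] turns the membership into a relation modulo the constant family with coefficients [s r]
    times powers of ['X]. These vanish by [free_base_change], and [{poly k}] is a domain. *)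
Lemma orbit_closure_free (s : 'I_g -> {poly k}) :
  F (\sum_r Acst c (s r) * Amon _ c (l r)) -> forall r, s r = 0.
Proof.
move=> [N [b [Bb E]]] r.
(* The sum of all weights is a common upper bound, as [Aflip] requires. *)
pose W := (\sum_j w j)%N.
have wW j : (w j <= W)%N by rewrite /W (bigD1 j) //= leq_addr.
move/(congr1 (Aflip wt W 'X)): E.
rewrite (Aflip_torus m_gt0 c_le) // mulr_sumr.
under eq_bigr => i _ do rewrite mulrA -rmorphM.
rewrite (@Aflip_sum _ _ _ _ n _ _ _ (fun i => 'X^N * s i) l) // => E.
pose t i := 'X^N * s i * 'X^(W - w (l i)).
have t0 : t r = 0.
  apply: (@free_base_change _ _ _ B g (fun i => Amon k c (l i)) sB l_free).
  under eq_bigr => i _ do rewrite Abase_mon.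
  by rewrite E; apply: subalgebraZ => //; apply: base_change_subalgebra.
apply/eqP; move/eqP: t0; rewrite /t mulrAC -exprD mulf_eq0 expf_eq0.
by rewrite polyX_eq0 andbF.
Qed.

(** Scalars of [k] lift to constant polynomials, so the image of [F] at ['X = 0] is already a
    submodule and the span adds nothing. *)
Lemma limit_image a : L a -> exists2 v, F v & Abase (horner_eval 0) v = a.
Proof.
have [_ FD _] := sF.
move: a.
apply: span_ind => [|_ [v Fv ->]|_ _ [v Fv <-] [u Fu <-]|s _ [v Fv <-]].
- by exists 0; [apply: subalgebra0 sF | rewrite rmorph0].
- by exists v.
- by exists (v + u); [apply: FD | rewrite rmorphD].
- exists (Acst c s%:P * v); first exact: subalgebraZ.
  by rewrite rmorphM /= Abase_cst; congr (Acst _ _ * _); apply: hornerC.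
Qed.

(** In each coefficient, [s j] minus its value at [0] has the root [0], hence the factor ['X]. *)
Lemma Abase_horner0 (v : Aplus {poly k} c) :
  exists u, v = Abase polyC (Abase (horner_eval 0) v) + Acst c 'X * u.
Proof.
have [s ->] := Amon_span m_gt0 c_le v.
have sE j : exists q : {poly k}, s j = ((s j).[0])%:P + 'X * q.
  have : root (s j - ((s j).[0])%:P) 0 by rewrite rootE !hornerE subrr.
  case/factor_theorem => q /eqP; rewrite subr0 subr_eq addrC mulrC => /eqP E.
  by exists q.
have [q qE] := choice sE.
exists (\sum_j Acst c (q j) * Amon _ c j).
rewrite !Abase_comb mulr_sumr -big_split /=; apply: eq_bigr => j _.
by rewrite mulrA -rmorphM -mulrDl -rmorphD /horner_eval -qE.
Qed.

Section FreeLimit.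
Hypothesis l_gen : forall v, exists s : 'I_g -> {poly k},
  F (v - \sum_r Acst c (s r) * Amon _ c (l r)).

(** A relation in the fibre lifts to some [v] in [F] equal to the combination plus ['X * u].
    Reducing [u] to basis monomials modulo [F] gives a relation with coefficients
    [(s r)%:P + 'X * q r]; these vanish, in particular at [0]. *)
Lemma limit_free (s : 'I_g -> k) :
  L (\sum_r Acst c (s r) * Amon k c (l r)) -> forall r, s r = 0.
Proof.
case/limit_image => v Fv Ev r.
have [u vE] := Abase_horner0 v; have [q Fq] := l_gen u.
have /orbit_closure_free/(_ r) :
    F (\sum_r Acst c ((s r)%:P + 'X * q r) * Amon _ c (l r)).
  have := subalgebraB sF Fv (subalgebraZ 'X sF Fq).
  rewrite {1}vE Ev mulrBr opprB addrACA subrr addr0; congr F.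
  rewrite Abase_comb mulr_sumr -big_split; apply: eq_bigr => i _ /=.
  by rewrite mulrA -rmorphM -mulrDl -rmorphD.
by move/(congr1 (horner_eval 0)); rewrite /horner_eval !hornerE.
Qed.

End FreeLimit.

(** At ['X = 0] the factor ['X^(w (l r) - w j)] becomes [1] for equal weights and [0] for a larger
    weight, so only the part of weight [w j] survives. *)
Lemma limit_relation j (a : 'I_g -> k) :
  B (Amon k c j - \sum_r Acst c (a r) * Amon k c (l r)) ->
  (forall r, a r != 0 -> (w j <= w (l r))%N) ->
  L (Amon k c j - \sum_r Acst c (if w (l r) == w j then a r else 0)
                         * Amon k c (l r)).
Proof.
move=> Bj wj; have :=
  base_change_image (horner_eval 0) (orbit_closure_relation Bj wj).
congr (base_change _ _ _); rewrite rmorphB rmorph_sum /= Abase_mon.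
congr (_ - _); apply: eq_bigr => r _.
rewrite rmorphM /= Abase_cst Abase_mon; congr (Acst _ _ * _).
rewrite -[LHS]/(_.[0]) hornerZ hornerXn expr0n subn_eq0.
have [->|ar] := eqVneq (a r) 0; first by rewrite mul0r if_same.
by rewrite eqn_leq (wj _ ar) andbT; case: ifP => _; rewrite ?mulr1 ?mulr0.
Qed.

End Limit.

(** The same monomials are a basis modulo [B], modulo the orbit closure and modulo its fibre, so all
    three quotients have rank [g]. *)
Lemma limit_homogeneous (k : fieldType) (m : nat) (c : posvec m) (g : nat)
    (B : Ter k c g) (wt : 'I_m -> nat) (n : nat) :
  (0 < m)%N -> (forall i, (c i <= n)%N) ->
  exists L : Ter k c g, is_limit (weight_subgroup wt) B L /\
    exists l : 'I_g -> 'I_m * 'I_n,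
      (forall j : 'I_m * 'I_n, exists a : 'I_g -> k,
        L (Amon k c j - \sum_r Acst c (a r) * Amon k c (l r)) /\
        forall r, a r != 0 -> mon_weight wt (l r) = mon_weight wt j) /\
      (forall s : 'I_g -> k, L (\sum_r Acst c (s r) * Amon k c (l r)) ->
        forall r, s r = 0).
Proof.
move=> m_gt0 c_le; have sB := ter_subalgebra B.
have [l [a [aB l_free wa]]] :=
  heaviest_basis B (mon_weight wt (n := n)) (@Amon_span k m c n m_gt0 c_le).
have sF := orbit_closure_subalgebra wt sB.
have Frel (j : 'I_m * 'I_n) : exists s : 'I_g -> {poly k},
    orbit_closure wt B (Amon _ c j - \sum_r Acst c (s r) * Amon _ c (l r)).
  exists (fun r => a j r *: 'X^(mon_weight wt (l r) - mon_weight wt j)).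
  exact: orbit_closure_relation (aB j) (wa j).
have Fgen := quotient_gen_of_span sF (Amon_span m_gt0 c_le) Frel.
have Ffree := orbit_closure_free m_gt0 c_le sB l_free.
pose F : Ter {poly k} c g :=
  MkTer sF (quotient_free_locally_free Fgen (Ffree _)).
have sL := base_change_subalgebra (horner_eval (0 : k)) sF.
have Lrel (j : 'I_m * 'I_n) : exists s : 'I_g -> k, base_change (horner_eval 0)
    (orbit_closure wt B) (Amon k c j - \sum_r Acst c (s r) * Amon k c (l r)).
  exists (fun r => if mon_weight wt (l r) == mon_weight wt j then a j r else 0).
  exact: limit_relation (aB j) (wa j).
have Lgen := quotient_gen_of_span sL (Amon_span m_gt0 c_le) Lrel.
have Lfree := limit_free m_gt0 c_le sB l_free Fgen.
exists (MkTer sL (quotient_free_locally_free Lgen Lfree)); split.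
  by exists F; split=> // S f Uf; apply: orbit_closure_extends.
exists l; split=> // j.
exists (fun r => if mon_weight wt (l r) == mon_weight wt j then a j r else 0).
split; first exact: limit_relation (aB j) (wa j).
by move=> r; case: (mon_weight _ _ =P _) => // _; rewrite eqxx.
Qed.

(** * Restriction to a subset of the variables *)

Section Restriction.
Variables (k : fieldType) (m : nat) (c : posvec m) (n : nat).
Hypothesis c_le : forall i, (c i <= n)%N.
Variables (K : {set 'I_m}).
Hypothesis K_neq0 : K != set0.

Lemma Aincl_mon (j : 'I_#|K| * 'I_n) :
  Aincl (Amon k (posvec_restr c K) j) = Amon k c (enum_val j.1, j.2).
Proof. by rewrite rmorphXn /= Aincl_gen. Qed.

Lemma Amon_incl (j : 'I_m * 'I_n) : j.1 \in K ->
  exists j' : 'I_#|K| * 'I_n,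
    j'.2 = j.2 /\ Aincl (Amon k (posvec_restr c K) j') = Amon k c j.
Proof.
case: j => i d /= iK; exists (enum_rank_in iK i, d).
by rewrite Aincl_mon /= enum_rankK_in.
Qed.

(** The basis monomials in variables from [K] form a basis modulo the preimage of [L]: they generate
    because the relation of a monomial on [K] stays on [K], and they are independent as a
    subfamily. *)
Lemma Ter_restr (L : Aplus k c -> Prop) (g : nat) (l : 'I_g -> 'I_m * 'I_n) :
  subalgebra L ->
  (forall s : 'I_g -> k, L (\sum_r Acst c (s r) * Amon k c (l r)) ->
     forall r, s r = 0) ->
  (forall j : 'I_m * 'I_n, j.1 \in K -> exists a : 'I_g -> k,
     L (Amon k c j - \sum_r Acst c (a r) * Amon k c (l r)) /\
     forall r, a r != 0 -> (l r).1 \in K) ->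
  exists BK : Ter k (posvec_restr c K) #|[set r | (l r).1 \in K]|,
    forall b, BK b <-> L (Aincl b).
Proof.
move=> sL l_free l_gen; have [Lc LD LM] := sL.
set J := [set r | _]; pose BK b := L (@Aincl k m c K b).
have sBK : subalgebra BK.
  split=> [s|a b La Lb|a b La Lb]; rewrite /BK.
  - by rewrite Aincl_cst; apply: Lc.
  - by rewrite rmorphD; apply: LD.
  - by rewrite rmorphM; apply: LM.
have JK (i : 'I_#|J|) : (l (enum_val i)).1 \in K.
  by have := enum_valP i; rewrite inE.
have [e' eE] := choice (fun i => Amon_incl (JK i)).
pose e i := Amon k (posvec_restr c K) (e' i).
have {}eE i : Aincl (e i) = Amon k c (l (enum_val i)) by case: (eE i).
have K_gt0 : (0 < #|K|)%N by rewrite card_gt0.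
have BKgen := quotient_gen_of_span (e := e) sBK
  (@Amon_span k _ (posvec_restr c K) n K_gt0 (fun r => c_le (enum_val r))).
suff BKlf : quotient_locally_free #|J| BK by exists (MkTer sBK BKlf).
apply: (@quotient_free_locally_free _ _ _ _ _ e) => [|s].
  apply: BKgen => j.
  have [|a [La aK]] := l_gen (enum_val j.1, j.2); first exact: enum_valP.
  exists (fun i => a (enum_val i)); rewrite /BK rmorphB /= Aincl_mon rmorph_sum.
  under eq_bigr => i _ do rewrite rmorphM /= Aincl_cst eE.
  rewrite -(big_enum_val (fun r => Acst c (a r) * Amon k c (l r))).
  move: La; congr (L (_ - _)); rewrite [RHS]big_mkcond /=.
  apply: eq_bigr => r _; case: ifPn => //; rewrite inE => lrK.
  have [->|/aK] := eqVneq (a r) 0; first by rewrite rmorph0 mul0r.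
  by rewrite (negPf lrK).
rewrite /BK rmorph_sum.
under eq_bigr => i _ do rewrite rmorphM /= Aincl_cst eE.
rewrite (partition_big enum_val predT) //= => Ls i.
(* The extension of [s] by zero from [J] to ['I_g], to which [l_free] applies. *)
pose t r := \sum_(i : 'I_#|J| | enum_val i == r) s i.
suff -> : s i = t (enum_val i).
  apply: l_free; move: Ls; congr L; apply: eq_bigr => r _.
  by rewrite rmorph_sum mulr_suml; apply: eq_bigr => h /eqP->.
rewrite /t (big_pred1 i) // => h.
by rewrite (inj_eq enum_val_inj).
Qed.

(** The subset [j_K(m)] of [A_c], for [m] the ideal of the restricted vector. *)
Definition Aincl_max (a : Aplus k c) : Prop :=
  exists2 b : Aplus k (posvec_restr c K), Amax b & Aincl b = a.

Lemma Aincl_max0 : Aincl_max 0.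
Proof.
exists 0; last by rewrite rmorph0.
by exists (fun=> 0); rewrite big1 // => i _; rewrite mul0r.
Qed.

Lemma Aincl_maxD a b : Aincl_max a -> Aincl_max b -> Aincl_max (a + b).
Proof.
move=> [x [f ->] <-] [y [h ->] <-].
exists (\sum_i f i * Agen _ _ i + \sum_i h i * Agen _ _ i); last exact: rmorphD.
exists (fun i => f i + h i); rewrite -big_split.
by apply: eq_bigr => i _; rewrite mulrDl.
Qed.

Lemma Aincl_maxZ s a : Aincl_max a -> Aincl_max (Acst c s * a).
Proof.
move=> [x [f ->] <-]; exists (Acst _ s * \sum_i f i * Agen _ _ i).
  exists (fun i => Acst _ s * f i); rewrite mulr_sumr.
  by apply: eq_bigr => i _; rewrite mulrA.
by rewrite rmorphM /= Aincl_cst.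
Qed.

Lemma Aincl_max_mon (j : 'I_m * 'I_n) :
  j.1 \in K -> (0 < j.2)%N -> Aincl_max (Amon k c j).
Proof.
move=> /Amon_incl[[i d] /= [<- <-]] d_gt0.
exists (Amon k (posvec_restr c K) (i, d)) => //.
exists (fun r => if r == i then Agen _ _ i ^+ d.-1 else 0).
rewrite (bigD1 i) //= eqxx -exprSr prednK // big1 ?addr0 // => r /negPf->.
by rewrite mul0r.
Qed.

Lemma Aincl_max_comb (j : 'I_m * 'I_n) g (a : 'I_g -> k)
    (l : 'I_g -> 'I_m * 'I_n) :
  j.1 \in K -> (0 < j.2)%N ->
  (forall r, a r != 0 -> (l r).1 \in K /\ (0 < (l r).2)%N) ->
  Aincl_max (Amon k c j - \sum_r Acst c (a r) * Amon k c (l r)).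
Proof.
move=> jK j_gt0 aP; apply: Aincl_maxD; first exact: Aincl_max_mon.
rewrite -mulN1r -(rmorph1 (Acst c)) -rmorphN; apply: Aincl_maxZ.
apply: (big_ind Aincl_max) => [||r _]; [exact: Aincl_max0|exact: Aincl_maxD|].
have [->|/aP[lK l_gt0]] := eqVneq (a r) 0.
  by rewrite rmorph0 mul0r; apply: Aincl_max0.
exact/Aincl_maxZ/Aincl_max_mon.
Qed.

End Restriction.

(** * Splitting of the limit along the two subsets *)

Theorem lemma1p8 (m : nat) (c : posvec m) (g : nat) (k : fieldType)
    (B : Ter k c g) (I I' : {set 'I_m})
    (hI : I != set0) (hI' : I' != set0)
    (hdisj : [disjoint I & I']) (hcover : I :|: I' = [set: 'I_m]) :
  exists gamma : one_param_subgroup m,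
    exists L : Ter k c g, is_limit gamma B L /\
      exists (gI gI' : nat) (B1 : Ter k (posvec_restr c I) gI)
             (B2 : Ter k (posvec_restr c I') gI'),
        (gI + gI')%N = g /\ same_set L (transverse_union B1 B2).
Proof.
have I'E : I' = ~: I.
  apply/setP => i; have := in_setT i; rewrite -hcover !inE.
  by case: (boolP (i \in I)) => //= iI _; rewrite (disjointFr hdisj iI).
have [i0 _] := set0Pn _ hI.
have m_gt0 : (0 < m)%N := leq_ltn_trans (leq0n i0) (ltn_ord i0).
pose n := (\max_i c i)%N.
have c_le i : (c i <= n)%N by apply: leq_bigmax.
pose wt (i : 'I_m) : nat := i \in I.
have [L [limL [l [l_gen l_free]]]] := limit_homogeneous B wt m_gt0 c_le.
exists (weight_subgroup wt), L; split=> //.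
have sL := ter_subalgebra L; have [Lc LD LM] := sL.
have L1 : L 1 by rewrite -(rmorph1 (Acst c)); apply: Lc.
(* The unit lies in [L], so it cannot occur in a family independent modulo [L]. *)
have l_gt0 r : (0 < (l r).2)%N.
  rewrite lt0n; apply/negP => /eqP lr0; have /eqP := oner_neq0 k; apply.
  have := l_free (fun i => (i == r)%:R) _ r; rewrite eqxx; apply.
  rewrite (bigD1 r) //= eqxx rmorph1 mul1r big1 => [|i /negPf->]; last first.
    by rewrite rmorph0 mul0r.
  by rewrite addr0 /Amon lr0 expr0.
(* For exponent [0] the relation is replaced by the membership of [1] in [L]. For positive exponents
   the weight is positive exactly on [I], so equal weights put [j] and [l r] on the same side. *)
have {}l_gen (j : 'I_m * 'I_n) : exists a : 'I_g -> k,
    L (Amon k c j - \sum_r Acst c (a r) * Amon k c (l r)) /\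
    forall r, a r != 0 -> (0 < j.2)%N /\ ((l r).1 \in I) = (j.1 \in I).
  have [j0|j_gt0] := posnP j.2.
    exists (fun=> 0); split=> [|r]; last by rewrite eqxx.
    rewrite big1 => [|r _]; last by rewrite rmorph0 mul0r.
    by rewrite subr0 /Amon j0 expr0.
  have [a [La aw]] := l_gen j; exists a; split=> // r /aw.
  rewrite /mon_weight /wt => E; split=> //; move: (l_gt0 r) j_gt0 E.
  case: (_ \in I) (_ \in I) => [] [] //; rewrite ?mul0n ?mul1n => + + E.
    by rewrite -E.
  by rewrite E.
have [|B1 B1L] := @Ter_restr k m c n c_le I hI L g l sL l_free.
  move=> j jI; have [a [La aI]] := l_gen j; exists a; split=> // r /aI[_ ->].
  exact: jI.
have [|B2 B2L] := @Ter_restr k m c n c_le I' hI' L g l sL l_free.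
  move=> j jI; have [a [La aI]] := l_gen j; exists a; split=> // r /aI[_].
  by move: jI; rewrite I'E !inE => + ->.
exists _, _, B1, B2; split.
  (* Each basis monomial has its variable in exactly one of [I] and [I']. *)
  rewrite -[RHS]card_ord -(cardsC [set r | (l r).1 \in I]); congr addn.
  by apply: eq_card => r; rewrite I'E !inE.
move=> a; split; last first.
  move=> [s [b1 [b2 [[/B1L Lb1 _] [/B2L Lb2 _] ->]]]].
  by apply: (LD) => //; apply: (LD) => //; apply: Lc.
have Uin s x1 x2 : L x1 -> L x2 -> Aincl_max I x1 -> Aincl_max I' x2 ->
    transverse_union B1 B2 (Acst c s + x1 + x2).
  move=> + + [b1 mb1 E1] [b2 mb2 E2]; rewrite -E1 -E2 => Lb1 Lb2.
  by exists s, b1, b2; split=> //; split=> //; [apply/B1L | apply/B2L].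
(* Keeping both parts inside [A_c] makes the decomposition visibly stable under linear
   combinations. *)
pose U x := exists s x1 x2, [/\ L x1, L x2, Aincl_max I x1, Aincl_max I' x2
                             & x = Acst c s + x1 + x2].
suff: L a -> U a by move=> LU /LU[s [x1 [x2 [? ? ? ? ->]]]]; apply: Uin.
have [b bP] := choice l_gen.
have L0 := subalgebra0 sL.
have max0 K := @Aincl_max0 k m c K.
(* A monomial minus its normal form modulo [L]: by homogeneity it lies in the constants, in [m_I] or
   in [m_I']. *)
pose y (j : 'I_m * 'I_n) := Amon k c j - \sum_r Acst c (b j r) * Amon k c (l r).
have Uy j : U (y j).
  have [Lj bj] := bP j; have [j0|j_gt0] := posnP j.2.
    exists 1, 0, 0; split=> //; rewrite rmorph1 !addr0 /y big1 => [|r _].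
      by rewrite subr0 /Amon j0 expr0.
    by have [->|/bj[]] := eqVneq (b j r) 0; rewrite ?rmorph0 ?mul0r ?j0.
  have [jI|jI] := boolP (j.1 \in I).
    exists 0, (y j), 0; rewrite rmorph0 add0r addr0; split=> //.
    by apply: Aincl_max_comb => // r /bj[_ ->].
  exists 0, 0, (y j); rewrite rmorph0 !add0r; split=> //.
  apply: Aincl_max_comb => // [|r /bj[_]]; rewrite I'E !inE //.
  by move=> ->.
have UD x1 x2 : U x1 -> U x2 -> U (x1 + x2).
  move=> [s [u1 [u2 [? ? ? ? ->]]]] [t [v1 [v2 [? ? ? ? ->]]]].
  exists (s + t), (u1 + v1), (u2 + v2).
  split; rewrite ?rmorphD; try exact: LD; try exact: Aincl_maxD.
  by rewrite addrACA (addrACA (Acst c s)).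
have UZ s x : U x -> U (Acst c s * x).
  move=> [t [x1 [x2 [? ? ? ? ->]]]].
  exists (s * t), (Acst c s * x1), (Acst c s * x2).
  split; try exact: subalgebraZ; try exact: Aincl_maxZ.
  by rewrite rmorphM -!mulrDr.
have U0 : U 0 by exists 0, 0, 0; split=> //; rewrite rmorph0 !addr0.
have [s aE] := Amon_span m_gt0 c_le a => La.
(* The difference of the two sides is a combination of basis monomials lying in [L], hence zero by
   independence. *)
suff -> : a = \sum_j Acst c (s j) * y j.
  by apply: (big_ind U) => // j _; apply/UZ/Uy.
have Ly : L (\sum_j Acst c (s j) * y j).
  by apply: subalgebra_sum => // j; apply: subalgebraZ => //; case: (bP j).
pose t r := \sum_j s j * b j r.
have dE : a - \sum_j Acst c (s j) * y j = \sum_r Acst c (t r) * Amon k c (l r).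
  rewrite aE -sumrB; under eq_bigr => j _.
    rewrite -mulrBr opprB addrC subrK mulr_sumr; over.
  rewrite exchange_big /=; apply: eq_bigr => r _.
  rewrite rmorph_sum mulr_suml; apply: eq_bigr => j _.
  by rewrite rmorphM mulrA.
apply/eqP; rewrite -subr_eq0 dE big1 // => r _.
have := subalgebraB sL La Ly; rewrite dE => /l_free/(_ r)->.
by rewrite rmorph0 mul0r.
Qed.
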